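(* Consider the problem of minimizing $f(x)$ over $x\in\mathbb{R}^n$ subject to $a_i^Tx-b_i=0$ for $i=1,\ldots,m_e$ and $a_i^Tx-b_i\ge 0$ for $i=m_e+1,\ldots,m$, where $a_i=(a_{i1},\ldots,a_{in})^T\in\mathbb{R}^n$, $b_i\in\mathbb{R}$, and $a_{ij}\ge 0$ for all $i=m_e+1,\ldots,m$ and $j=1,\ldots,n$. Suppose that Algorithm 1 is applied to solve this problem, with $f$ satisfying assumptions A1 and A3. Moreover, assume that at each outer iteration $k$ of Algorithm 1 a monotone method $\mathcal{M}_1$ satisfying A4 is used to approximately solve the subproblem $\min_{x\in\mathbb{R}^n}P(x,\lambda^{(k)},\sigma^{(k)})$ of Step 1, with starting point $$\tilde{x}_{k,0}=\arg\min\{P(y,\lambda^{(k)},\sigma^{(k)}) : y\in\{x_0,x_k\}\}.$$ Then the following statements are true: (a) If $\{\sigma^{(k)}\}_{k\ge 0}$ is bounded from above by $\sigma_{max}$, then Algorithm 1 takes at most $\mathcal{O}\left(\sigma_{max}\sqrt{n}\,|\log(\epsilon)|^2\epsilon^{-2}\right)$ inner iterations of $\mathcal{M}_1$ to generate an $\epsilon$-approximate KKT point of the problem. (b) If $\lim_{k\to+\infty}\sigma^{(k)}=+\infty$ and $\alpha\ge 2$ is an integer, then Algorithm 1 takes at most $\mathcal{O}\left(\sqrt{n}\,\epsilon^{-\left(\frac{2(2+\alpha)}{\alpha-1}+2\right)}\right)$ iterations of $\mathcal{M}_1$ to generate an $\epsilon$-approximate KKT point of the problem.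
   Context: Notation: $c_i(x)=a_i^Tx-b_i$; $c_E(x)=(c_1(x),\ldots,c_{m_e}(x))$, $c_I(x)=(c_{m_e+1}(x),\ldots,c_m(x))$; for a vector $v$, $v^{(-)}$ is the vector with components $\min\{v_i,0\}$. A point satisfying all the constraints is called feasible. Assumption A1: $f$ is continuously differentiable, bounded below by $f_{low}$, and for every $u\in\mathbb{R}$ the set $\{x\in\mathbb{R}^n: f(x)\le u\}$ is bounded. Assumption A3: $\nabla f$ is $L_1$-Lipschitz continuous, i.e. $\|\nabla f(x)-\nabla f(y)\|\le L_1\|x-y\|$ for all $x,y\in\mathbb{R}^n$ (Euclidean norm). Assumption A4 on $\mathcal{M}_1$: given any differentiable $g:\mathbb{R}^n\to\mathbb{R}$ bounded below by $g_{low}$ with $L$-Lipschitz gradient, the method $\mathcal{M}_1$ with starting point $\tilde{x}$ can find an $\epsilon$-approximate stationary point of $g$ (a point where $\|\nabla g\|_2\le\epsilon$) in at most $C_{\mathcal{M}_1}L(g(\tilde{x})-g_{low})\epsilon^{-2}$ iterations, where $C_{\mathcal{M}_1}$ is a positive constant that depends only on the method $\mathcal{M}_1$. Monotone means that the objective values along the iterates of $\mathcal{M}_1$ are nonincreasing. The iterations of $\mathcal{M}_1$ are called inner iterations; the bounds are on their total number over all outer iterations performed. Augmented Lagrangian: $P(x,\lambda,\sigma)=f(x)+\sum_{i=1}^{m_e}[-\lambda_ic_i(x)+\frac12\sigma c_i(x)^2]+\sum_{i=m_e+1}^m\psi_i(x)$, where $\psi_i(x)=-\lambda_ic_i(x)+\frac12\sigma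 c_i(x)^2$ if $c_i(x)<\lambda_i/\sigma$ and $\psi_i(x)=-\frac12\lambda_i^2/\sigma$ otherwise. Lagrangian: $L(x,\lambda)=f(x)-\sum_{i=1}^m\lambda_ic_i(x)$. Algorithm 1 (Augmented Lagrangian Method). Step 0: given a feasible point $x_0\in\mathbb{R}^n$, $\lambda^{(0)}\in\mathbb{R}^m$ with $\lambda_i^{(0)}\ge 0$ for $i=m_e+1,\ldots,m$, $\alpha>1$, $\sigma^{(0)}>0$ and $\gamma,\epsilon\in(0,1)$, set $k:=0$. Step 1: find an approximate solution $x_{k+1}$ to $\min_{x\in\mathbb{R}^n}P(x,\lambda^{(k)},\sigma^{(k)})$ such that $P(x_{k+1},\lambda^{(k)},\sigma^{(k)})\le\min\{P(x_k,\lambda^{(k)},\sigma^{(k)}),P(x_0,\lambda^{(k)},\sigma^{(k)})\}$ and $\|\nabla_xP(x_{k+1},\lambda^{(k)},\sigma^{(k)})\|_\infty\le\epsilon$. Step 2: compute $$\theta^{(k+1)}=\max\left\{\left\|\frac{\lambda^{(k)}}{\sigma^{(k)}}\right\|_\infty,\left\|c_E(x_{k+1})-\frac{\lambda_E^{(k)}}{\sigma^{(k)}}\right\|_\infty,\|c_I^{(-)}(x_{k+1})\|_\infty\right\},\qquad \lambda_E^{(k)}=(\lambda_1^{(k)},\ldots,\lambda_{m_e}^{(k)}).$$ If $k=0$, set $\sigma^{(k+1)}=\sigma^{(k)}$; otherwise set $\sigma^{(k+1)}=\sigma^{(k)}$ if $\theta^{(k+1)}\le\gamma\theta^{(k)}$,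 and $\sigma^{(k+1)}=\max\{(k+1)^\alpha,\sigma^{(k)}\}$ otherwise. Step 3: set $\lambda_i^{(k+1)}=\lambda_i^{(k)}-\sigma^{(k)}c_i(x_{k+1})$ for $i=1,\ldots,m_e$ and $\lambda_i^{(k+1)}=\max\{\lambda_i^{(k)}-\sigma^{(k)}c_i(x_{k+1}),0\}$ for $i=m_e+1,\ldots,m$. Step 4: set $k:=k+1$ and return to Step 1. $\epsilon$-approximate KKT point: a generated pair $(x_k,\lambda^{(k)})$ with $\|\nabla_xL(x_k,\lambda^{(k)})\|_\infty\le\epsilon$, $\|c_E(x_k)\|_\infty\le\epsilon$, $\|c_I^{(-)}(x_k)\|_\infty\le\epsilon$, and, for all $i\in\{m_e+1,\ldots,m\}$, $\lambda_i^{(k)}\ge 0$ and $\lambda_i^{(k)}=0$ whenever $c_i(x_k)>\epsilon$. Here $\epsilon\in(0,1)$ is the tolerance used in Algorithm 1. *)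

(* Defs.v *)
From mathcomp Require Export all_boot all_order all_algebra.
From mathcomp Require Export all_classical all_reals all_analysis.
Export Order.TTheory GRing.Theory Num.Theory numFieldNormedType.Exports.

Set Implicit Arguments.
Unset Strict Implicit.
Unset Printing Implicit Defensive.

Local Open Scope classical_set_scope.
Local Open Scope ring_scope.

(* Vectors are row vectors.  The library norm [`|v|] on ['rV_n] is the sup norm;
   [l2norm] is the Euclidean norm (the Frobenius norm on general matrices). *)
Definition l2norm (R : realType) p q (B : 'M[R]_(p, q)) : R :=
  Num.sqrt (\sum_(i < p) \sum_(j < q) B i j ^+ 2).

Definition grad (R : realType) n (g : 'rV[R]_n -> R) (x : 'rV[R]_n) : 'rV[R]_n :=
  \row_(j < n) 'D_(delta_mx 0 j) g x.

Definition negpart (R : realType) n (v : 'rV[R]_n) : 'rV[R]_n :=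
  \row_(i < n) Num.min (v 0 i) 0.

Definition lipschitz_grad (R : realType) n (L : R) (g : 'rV[R]_n -> R) : Prop :=
  forall x y, l2norm (grad g x - grad g y) <= L * l2norm (x - y).

Definition assumption_A1 (R : realType) n (f_low : R) (f : 'rV[R]_n -> R) : Prop :=
  [/\ (forall x, differentiable f x), continuous (grad f),
      (forall x, f_low <= f x)
    & (forall u : R, bounded_set [set x | f x <= u])].

Definition assumption_A3 (R : realType) n (L1 : R) (f : 'rV[R]_n -> R) : Prop :=
  lipschitz_grad L1 f.

Section Problem.
Variables (R : realType) (n me mi : nat).
Variables (f : 'rV[R]_n -> R) (A : 'M[R]_(me + mi, n)) (b : 'rV[R]_(me + mi)).

(* The first [me] of the [m = me + mi] constraints (indices [lshift mi i]) are
   the equalities, the last [mi] (indices [rshift me i]) the inequalities.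
   [constr x] has components [a_i^T x - b_i], where [a_i] is row [i] of [A]. *)
Definition constr (x : 'rV[R]_n) : 'rV[R]_(me + mi) := x *m A^T - b.

Definition consE (x : 'rV[R]_n) : 'rV[R]_me := lsubmx (constr x).

Definition consI (x : 'rV[R]_n) : 'rV[R]_mi := rsubmx (constr x).

Definition feasible (x : 'rV[R]_n) : Prop :=
  (forall i, consE x 0 i = 0) /\ (forall i, 0 <= consI x 0 i).

Definition lagrangian (lam : 'rV[R]_(me + mi)) (x : 'rV[R]_n) : R :=
  f x - \sum_(i < me + mi) lam 0 i * constr x 0 i.

Definition aug_psi (s l c : R) : R :=
  if c < l / s then - l * c + 2^-1 * s * c ^+ 2 else - (2^-1 * l ^+ 2 / s).

Definition aug_lag (lam : 'rV[R]_(me + mi)) (s : R) (x : 'rV[R]_n) : R :=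
  f x
  + \sum_(i < me) (- lsubmx lam 0 i * consE x 0 i + 2^-1 * s * consE x 0 i ^+ 2)
  + \sum_(i < mi) aug_psi s (rsubmx lam 0 i) (consI x 0 i).

Definition approx_KKT (eps : R) (x : 'rV[R]_n) (lam : 'rV[R]_(me + mi)) : Prop :=
  [/\ `|grad (lagrangian lam) x| <= eps,
      `|consE x| <= eps,
      `|negpart (consI x)| <= eps
    & forall i : 'I_mi, 0 <= rsubmx lam 0 i /\
        (eps < consI x 0 i -> rsubmx lam 0 i = 0)].

Section Algorithm.
Variables (x0 : 'rV[R]_n) (lam0 : 'rV[R]_(me + mi)) (alpha sigma0 gamma eps : R).
Variables (x : nat -> 'rV[R]_n) (lam : nat -> 'rV[R]_(me + mi)) (sigma : nat -> R).

(* Junk at [k = 0], where the algorithm does not use it. *)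
Definition theta (k : nat) : R :=
  Num.max `|(sigma k.-1)^-1 *: lam k.-1|
    (Num.max `|consE (x k) - (sigma k.-1)^-1 *: lsubmx (lam k.-1)|
             `|negpart (consI (x k))|).

Record AL_run : Prop := {
  AL_x0 : x 0%N = x0;
  AL_lam0 : lam 0%N = lam0;
  AL_sigma0 : sigma 0%N = sigma0;
  AL_decrease : forall k, aug_lag (lam k) (sigma k) (x k.+1) <=
    Num.min (aug_lag (lam k) (sigma k) (x k)) (aug_lag (lam k) (sigma k) x0);
  AL_stationary : forall k, `|grad (aug_lag (lam k) (sigma k)) (x k.+1)| <= eps;
  AL_sigma : forall k, sigma k.+1 =
    if (k == 0%N) || (theta k.+1 <= gamma * theta k) then sigma k
    else Num.max (k.+1%:R `^ alpha) (sigma k);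
  AL_lamE : forall k (i : 'I_me), lsubmx (lam k.+1) 0 i =
    lsubmx (lam k) 0 i - sigma k * consE (x k.+1) 0 i;
  AL_lamI : forall k (i : 'I_mi), rsubmx (lam k.+1) 0 i =
    Num.max (rsubmx (lam k) 0 i - sigma k * consI (x k.+1) 0 i) 0 }.

End Algorithm.
End Problem.

(* [iter_of M eps g y j] is the [j]-th iterate of [M] on the objective [g] from
   the starting point [y]; the iterates may depend on the target accuracy. *)
Record method (R : realType) (n : nat) := Method {
  iter_of :> R -> ('rV[R]_n -> R) -> 'rV[R]_n -> nat -> 'rV[R]_n;
  iter_of0 : forall eps g y, iter_of eps g y 0%N = y }.

Definition monotone_method (R : realType) n (M : method R n) : Prop :=
  forall (eps : R) (g : 'rV[R]_n -> R) (g_low L : R) (y : 'rV[R]_n),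
    0 < eps < 1 -> (forall x, differentiable g x) ->
    (forall x, g_low <= g x) -> lipschitz_grad L g ->
    forall j, g (M eps g y j.+1) <= g (M eps g y j).

Definition assumption_A4 (R : realType) n (CM : R) (M : method R n) : Prop :=
  forall (eps : R) (g : 'rV[R]_n -> R) (g_low L : R) (y : 'rV[R]_n),
    0 < eps < 1 -> (forall x, differentiable g x) ->
    (forall x, g_low <= g x) -> lipschitz_grad L g ->
    exists2 j : nat, j%:R <= CM * L * (g y - g_low) * eps ^- 2
                   & l2norm (grad g (M eps g y j)) <= eps.

Section Inner.
Variables (R : realType) (n me mi : nat).
Variables (f : 'rV[R]_n -> R) (A : 'M[R]_(me + mi, n)) (b : 'rV[R]_(me + mi)).
Variables (M : method R n) (eps : R).
Variables (x : nat -> 'rV[R]_n) (lam : nat -> 'rV[R]_(me + mi)) (sigma : nat -> R).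

(* At outer iteration [k], [M] is started at [y k] and [x k.+1] is its iterate
   number [N k].  The Step 1 test is part of [AL_run] and is in the sup norm,
   while A4 is in the Euclidean norm: [inner_stop] only says that [M] does not
   continue past its first Euclidean [eps]-stationary iterate, so stopping at
   the first iterate passing either test is covered. *)
Record inner_run (y : nat -> 'rV[R]_n) (N : nat -> nat) : Prop := {
  inner_start : forall k, y k = x 0%N \/ y k = x k;
  inner_argmin : forall k, aug_lag f A b (lam k) (sigma k) (y k) <=
    Num.min (aug_lag f A b (lam k) (sigma k) (x 0%N))
            (aug_lag f A b (lam k) (sigma k) (x k));
  inner_result : forall k,
    x k.+1 = M eps (aug_lag f A b (lam k) (sigma k)) (y k) (N k);
  inner_stop : forall k j, (j < N k)%N ->
    eps < l2norm (grad (aug_lag f A b (lam k) (sigma k))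
                    (M eps (aug_lag f A b (lam k) (sigma k)) (y k) j)) }.

(* For some [K >= 1], the pair produced by outer iteration [K] is an [eps]-KKT
   point and the outer iterations up to it use at most [B] inner ones in total. *)
Definition KKT_within (N : nat -> nat) (B : R) : Prop :=
  exists K : nat, [/\ (0 < K)%N, approx_KKT f A b eps (x K) (lam K)
                    & (\sum_(k < K) N k)%N%:R <= B].

End Inner.

(* Main.v *)
From HB Require Import structures.
Require Import Defs.
From mathcomp Require Import zify ring lra.

Set Implicit Arguments.
Unset Strict Implicit.
Unset Printing Implicit Defensive.

Local Open Scope classical_set_scope.
Local Open Scope ring_scope.

(** Completing squares, P(x, lam, s) = f(x) + (|mu|^2 - |lam|^2) / (2s), where
    mu is the multiplier produced by Step 3 at x; hence grad P = grad f - mu A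
    is (L1 + s |A|^2)-Lipschitz, and P(x_{k+1}) <= P(x0) <= f(x0) telescopes to
    |lam^(k+1)|^2 <= |lam^(0)|^2 + 2 (f(x0) - f_low) (k+1) sigma^(k).  So the
    gap of the k-th subproblem is O(k), its inner cost is O(sigma^(k) k eps^-2),
    and theta^(k+1)^2 = O(k / sigma^(k)); the total over K outer iterations is
    O(sigma K^2 eps^-2).  Since theta^(K) <= eps/2 implies approximate KKT, it
    remains to bound K.
    (a) Once k exceeds sigma_max the penalty test must succeed, so theta
    decreases geometrically and K = O(|ln eps|).
    (b) Inspect the window [T, 2T): if the penalty is updated there, sigma is at
    least T^alpha just after and theta^2 = O(T^(1-alpha)); otherwise theta^2
    gains the factor gamma^(2T).  Either way T of order eps^(-2/(alpha-1))
    suffices, with sigma = O(T^alpha). *)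

(** * Euclidean norm inequalities and comparison with the sup norm *)

Section Euclidean.
Context {R : realType}.

(** Lagrange's identity: the double sum of squares in the proof is twice the difference of the two
    sides. *)
Lemma sum_cauchy_schwarz (I : finType) (a b : I -> R) :
  (\sum_i a i * b i) ^+ 2 <= (\sum_i a i ^+ 2) * (\sum_i b i ^+ 2).
Proof.
have : 0 <= \sum_i \sum_j (a i * b j - a j * b i) ^+ 2.
  by apply: sumr_ge0 => i _; apply: sumr_ge0 => j _; exact: sqr_ge0.
have -> : \sum_i \sum_j (a i * b j - a j * b i) ^+ 2 =
    \sum_i \sum_j a i ^+ 2 * b j ^+ 2 + \sum_i \sum_j b i ^+ 2 * a j ^+ 2
    - 2 * \sum_i \sum_j (a i * b i) * (a j * b j).
  rewrite mulr_sumr -big_split -sumrB; apply: eq_bigr => i _ /=.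
  rewrite mulr_sumr -big_split -sumrB; apply: eq_bigr => j _ /=.
  by ring.
rewrite -!big_distrlr /= -expr2 [X in _ + X - _]mulrC; lra.
Qed.

Lemma sqr_l2norm p q (B : 'M[R]_(p, q)) :
  l2norm B ^+ 2 = \sum_i \sum_j B i j ^+ 2.
Proof.
rewrite sqr_sqrtr//; apply: sumr_ge0 => i _; apply: sumr_ge0 => j _.
exact: sqr_ge0.
Qed.

Lemma sqr_l2norm_row n (v : 'rV[R]_n) : l2norm v ^+ 2 = \sum_j v 0 j ^+ 2.
Proof. by rewrite sqr_l2norm big_ord1. Qed.

Lemma l2norm_ge0 p q (B : 'M[R]_(p, q)) : 0 <= l2norm B.
Proof. exact: sqrtr_ge0. Qed.

Lemma ler_l2norm p q p' q' (B : 'M[R]_(p, q)) (B' : 'M[R]_(p', q')) c :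
  0 <= c -> l2norm B ^+ 2 <= c ^+ 2 * l2norm B' ^+ 2 ->
  l2norm B <= c * l2norm B'.
Proof.
move=> c0; rewrite -exprMn ler_sqr// nnegrE ?l2norm_ge0//.
by rewrite mulr_ge0// l2norm_ge0.
Qed.

Lemma l2normD n (u v : 'rV[R]_n) : l2norm (u + v) <= l2norm u + l2norm v.
Proof.
rewrite -ler_sqr ?nnegrE ?addr_ge0 ?l2norm_ge0// sqrrD !sqr_l2norm_row.
have -> : \sum_j (u + v) 0 j ^+ 2 =
    \sum_j u 0 j ^+ 2 + 2 * (\sum_j u 0 j * v 0 j) + \sum_j v 0 j ^+ 2.
  rewrite mulr_sumr -!big_split; apply: eq_bigr => j _ /=.
  by rewrite mxE; ring.
have := sum_cauchy_schwarz (fun j => u 0 j) (fun j => v 0 j).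
rewrite -!sqr_l2norm_row -exprMn -[X in X <= _]real_normK ?num_real//.
rewrite ler_sqr ?nnegrE ?mulr_ge0 ?l2norm_ge0// => /(le_trans (ler_norm _)).
by move=> h; rewrite lerD2r lerD2l mulr2n; lra.
Qed.

Lemma l2norm_mulmx m n (u : 'rV[R]_m) (B : 'M[R]_(m, n)) :
  l2norm (u *m B) <= l2norm B * l2norm u.
Proof.
apply: ler_l2norm; first exact: l2norm_ge0.
rewrite !sqr_l2norm_row sqr_l2norm [leRHS]mulrC exchange_big mulr_sumr /=.
apply: ler_sum => j _; rewrite mxE.
exact: (sum_cauchy_schwarz (fun i => u 0 i) (fun i => B i j)).
Qed.

Lemma l2normN p q (B : 'M[R]_(p, q)) : l2norm (- B) = l2norm B.
Proof.
congr Num.sqrt; apply: eq_bigr => i _; apply: eq_bigr => j _.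
by rewrite mxE sqrrN.
Qed.

Lemma l2norm_tr p q (B : 'M[R]_(p, q)) : l2norm B^T = l2norm B.
Proof.
rewrite /l2norm exchange_big; congr Num.sqrt.
by apply: eq_bigr => i _; apply: eq_bigr => j _; rewrite mxE.
Qed.

Lemma row_normP n (v : 'rV[R]_n) (c : R) : 0 <= c ->
  reflect (forall j, `|v 0 j| <= c) (`|v| <= c).
Proof.
move=> c0; rewrite [`|v|]mx_normrE; apply: (iffP idP) => [/bigmax_leP[_ h] j|h].
  exact: (h (0, j)).
by apply/bigmax_leP; split=> // -[i j] _ /=; rewrite ord1.
Qed.

Lemma row_norm_coord n (v : 'rV[R]_n) j : `|v 0 j| <= `|v|.
Proof. by apply: row_normP. Qed.

Lemma row_norm_le_l2norm n (v : 'rV[R]_n) : `|v| <= l2norm v.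
Proof.
apply/row_normP => [|j]; first exact: l2norm_ge0.
rewrite -ler_sqr ?nnegrE ?l2norm_ge0// real_normK ?num_real//.
rewrite sqr_l2norm_row (bigD1 j)//= lerDl.
by apply: sumr_ge0 => i _; exact: sqr_ge0.
Qed.

End Euclidean.

(** * Differential calculus of the augmented Lagrangian *)

Section AugmentedLagrangian.
Context {R : realType}.

(** The flag is true for equality constraints, whose multipliers are not projected, so that both
    kinds of constraint are handled at once. *)
Definition clip (b : bool) (t : R) : R := if b then t else Num.max t 0.

Lemma clip_lipschitz c t u : `|clip c t - clip c u| <= `|t - u|.
Proof.
case: c => //=.
have [t0|t0] := leP t 0; have [u0|u0] := leP u 0.
- by rewrite subrr normr0.
- by rewrite sub0r normrN gtr0_norm// distrC ler_normr; apply/orP; left; lra.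
- by rewrite subr0 gtr0_norm// ler_normr; apply/orP; left; lra.
- by [].
Qed.

(** The positive part has a kink at 0, but its square does not: the quadratic remainder survives a
    change of sign between [t] and [t + h]. *)
Lemma sqr_clip_taylor c t h :
  `|clip c (t + h) ^+ 2 - clip c t ^+ 2 - h * (2 * clip c t)| <= h ^+ 2.
Proof.
rewrite ler_norml; case: c => /=; first by apply/andP; split; nra.
have [t0|t0] := leP t 0; have [u0|u0] := leP (t + h) 0;
  by apply/andP; split; nra.
Qed.

Lemma is_diff_sqr_clip c t :
  is_diff t (fun u => clip c u ^+ 2) (fun h => h *: (2 * clip c t)).
Proof.
set g := fun u => clip c u ^+ 2.
have cv : h^-1 *: ((g \o shift t) (h *: 1) - g t) @[h --> 0^'] -->
    2 * clip c t.
  apply/cvgrPdist_le => e e0; near=> h.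
  have h0 : h != 0 by near: h; exact: nbhs_dnbhs_neq.
  rewrite distrC.
  have -> : h^-1 *: ((g \o shift t) (h *: 1) - g t) - 2 * clip c t =
      h^-1 * (g (t + h) - g t - h * (2 * clip c t)).
    by rewrite /= /GRing.scale/= mulr1 (addrC h); field.
  rewrite normrM normfV ler_pdivrMl ?normr_gt0//.
  apply: le_trans (sqr_clip_taylor _ _ _) _.
  rewrite -real_normK ?num_real// expr2 ler_wpM2l//.
  near: h; apply: dnbhs0_le => //.
have dg : derivable g t 1 by apply/cvg_ex; exists (2 * clip c t).
apply: DiffDef; first exact/derivable1_diffP.
rewrite diff1E; last exact/derivable1_diffP.
by rewrite derive1E /derive (cvg_lim _ cv).
Unshelve. all: by end_near. Qed.

Lemma is_diff_sum (V W : normedModType R) n (h dh : 'I_n -> V -> W) x :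
  (forall i, is_diff x (h i) (dh i)) ->
  is_diff x (\sum_(i < n) h i) (\sum_(i < n) dh i).
Proof.
by elim/big_ind2 : _ => // [_|*]; [exact: is_diff_cst|exact: is_diffD].
Qed.

Lemma is_diff_mulmx_coord n m (B : 'M[R]_(n, m)) i (x : 'rV[R]_n) :
  is_diff x (fun z : 'rV[R]_n => (z *m B) 0 i) (fun z => (z *m B) 0 i).
Proof.
set F := fun z : 'rV[R]_n => (z *m B) 0 i.
have FE : F = \sum_(j < n) (B j i *: (fun z : 'rV[R]_n => z 0 j)).
  rewrite fct_sumE; apply/funext => z; rewrite /F mxE.
  by apply: eq_bigr => j _; rewrite mulrC.
have dF z : differentiable F z.
  rewrite FE; apply: differentiable_sum => j.
  by apply: differentiableZ; exact: differentiable_coord.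
(* A continuous linear map is its own differential; continuity comes from the expansion in
   coordinates. *)
have linF : linear F by move=> a u v; rewrite /F mulmxDl -scalemxAl !mxE.
pose linM := GRing.isLinear.Build _ _ _ _ _ linF.
pose L : {linear 'rV[R]_n -> R} := HB.pack F linM.
apply: DiffDef; first exact: dF.
by apply: (@diff_lin _ _ _ L) => z; exact: differentiable_continuous.
Qed.

Context {n me mi : nat}.
Variables (f : 'rV[R]_n -> R) (A : 'M[R]_(me + mi, n)) (b : 'rV[R]_(me + mi)).
Implicit Types (lam : 'rV[R]_(me + mi)) (x : 'rV[R]_n) (s : R).

(** The update of Step 3 at an arbitrary point, hence a function of [x] whose square can be
    differentiated. *)
Definition multiplier lam s x : 'rV[R]_(me + mi) :=
  \row_i clip (i < me)%N (lam 0 i - s * constr A b x 0 i).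

Lemma multiplierE lam s x (i : 'I_me) : lsubmx (multiplier lam s x) 0 i =
  lsubmx lam 0 i - s * consE A b x 0 i.
Proof. by rewrite /consE !mxE /= ltn_ord. Qed.

Lemma multiplierI lam s x (i : 'I_mi) : rsubmx (multiplier lam s x) 0 i =
  Num.max (rsubmx lam 0 i - s * consI A b x 0 i) 0.
Proof. by rewrite /consI !mxE /= ltnNge leq_addr. Qed.

(* Completing the squares; the paper's case distinction in [aug_psi] becomes
   the projection in the multiplier update of Step 3. *)
Lemma aug_lagE lam s x : 0 < s -> aug_lag f A b lam s x =
  f x + (2 * s)^-1 * (l2norm (multiplier lam s x) ^+ 2 - l2norm lam ^+ 2).
Proof.
move=> s0; rewrite /aug_lag !sqr_l2norm_row -sumrB mulr_sumr big_split_ord /=.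
rewrite -addrA; congr (_ + (_ + _)); apply: eq_bigr => i _.
  have := multiplierE lam s x i; rewrite mxE => ->.
  by rewrite mxE; field; rewrite gt_eqF.
have := multiplierI lam s x i; rewrite mxE => ->.
set c := consI A b x 0 i; rewrite mxE /aug_psi; set l := lam 0 _.
rewrite ltr_pdivlMr// (mulrC c) -subr_gt0; case: ltP => h.
  by field; rewrite gt_eqF.
by field; rewrite gt_eqF.
Qed.

Lemma is_diff_sqr_multiplier lam s i x :
  is_diff x (fun z => multiplier lam s z 0 i ^+ 2)
    (fun v => (- s * (v *m A^T) 0 i) * (2 * multiplier lam s x 0 i)).
Proof.
have h1 : is_diff x (fun z : 'rV[R]_n => lam 0 i - s * constr A b z 0 i)
    (fun v => - s * (v *m A^T) 0 i).
  have -> : (fun z : 'rV[R]_n => lam 0 i - s * constr A b z 0 i) =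
      cst (lam 0 i + s * b 0 i) + (- s) *: (fun z => (z *m A^T) 0 i).
    apply/funext => z; rewrite !fctE /constr !mxE /GRing.scale /=.
    by ring.
  have -> : (fun v : 'rV[R]_n => - s * (v *m A^T) 0 i) =
      0 + (- s) *: (fun v => (v *m A^T) 0 i) by rewrite add0r.
  apply: is_diffD; apply: is_diffZ; exact: is_diff_mulmx_coord.
have := is_diff_comp h1 (is_diff_sqr_clip (i < me)%N _).
have -> : (fun z => multiplier lam s z 0 i ^+ 2) =
  (fun u => clip (i < me)%N u ^+ 2) \o
    (fun z : 'rV[R]_n => lam 0 i - s * constr A b z 0 i).
  by apply/funext => z /=; rewrite /multiplier mxE.
by rewrite /multiplier mxE.
Qed.

(** The chain rule on each square yields the factors [- s] and [2], which cancel [(2 * s)^-1] up to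
    sign. *)
Lemma is_diff_aug_lag lam s x : 0 < s -> differentiable f x ->
  is_diff x (aug_lag f A b lam s)
    (fun v => 'd f x v - \sum_i multiplier lam s x 0 i * (v *m A^T) 0 i).
Proof.
move=> s0 df.
have -> : aug_lag f A b lam s = f + ((2 * s)^-1 *:
    ((\sum_i (fun z => multiplier lam s z 0 i ^+ 2))
     + cst (- l2norm lam ^+ 2))).
  by apply/funext => z; rewrite aug_lagE// fct_sumE sqr_l2norm_row.
have := is_diffD (differentiableP df) (is_diffZ (2 * s)^-1 (is_diffD
  (is_diff_sum (fun i => is_diff_sqr_multiplier lam s i x))
  (is_diff_cst (- l2norm lam ^+ 2) x))).
move/is_diff_eq; apply; rewrite fct_sumE; apply/funext => v.
rewrite !fctE addr0 /GRing.scale/= mulr_sumr -sumrN; congr (_ + _).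
by apply: eq_bigr => i _; field; rewrite gt_eqF.
Qed.

Lemma differentiable_aug_lag lam s x : 0 < s -> differentiable f x ->
  differentiable (aug_lag f A b lam s) x.
Proof. by move=> s0 df; have [] := is_diff_aug_lag lam s0 df. Qed.

Lemma grad_aug_lag lam s x : 0 < s -> differentiable f x ->
  grad (aug_lag f A b lam s) x = grad f x - multiplier lam s x *m A.
Proof.
move=> s0 df; have [d1 d2] := is_diff_aug_lag lam s0 df.
apply/rowP => j; rewrite !mxE !deriveE// d2; congr (_ - _).
by apply: eq_bigr => i _; rewrite -rowE !mxE.
Qed.

(** With [grad_aug_lag], this shows that stationarity of the augmented Lagrangian is stationarity of
    the Lagrangian at the updated multiplier. *)
Lemma grad_lagrangian lam x : differentiable f x ->
  grad (lagrangian f A b lam) x = grad f x - lam *m A.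
Proof.
move=> df; have -> : lagrangian f A b lam = f - ((\sum_i
    lam 0 i *: (fun z : 'rV[R]_n => (z *m A^T) 0 i)) -
    cst (\sum_i lam 0 i * b 0 i)).
  apply/funext => z; rewrite /lagrangian fct_sumE !fctE -sumrB.
  congr (_ - _); apply: eq_bigr => i _.
  by rewrite /constr [X in _ * X]mxE [X in _ + X]mxE mulrBr.
have [d1 d2] := is_diffB (differentiableP df) (is_diffB
  (is_diff_sum (fun i => is_diffZ (lam 0 i) (is_diff_mulmx_coord A^T i x)))
  (is_diff_cst (\sum_i lam 0 i * b 0 i) x)).
apply/rowP => j; rewrite !mxE !deriveE// d2 fct_sumE !fctE subr0.
congr (_ - _); apply: eq_bigr => i _.
transitivity (lam 0 i * ((delta_mx 0 j : 'rV[R]_n) *m A^T) 0 i) => //.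
by rewrite -rowE !mxE.
Qed.

(** The projection is nonexpansive in each coordinate, so only the affine map inside it matters. *)
Lemma multiplier_lipschitz lam s x y : 0 <= s ->
  l2norm (multiplier lam s x - multiplier lam s y) <=
  s * l2norm A * l2norm (x - y).
Proof.
move=> s0; rewrite -mulrA.
apply: (@le_trans _ _ (s * l2norm ((x - y) *m A^T))); last first.
  by rewrite ler_wpM2l// -[l2norm A]l2norm_tr l2norm_mulmx.
apply: ler_l2norm => //; rewrite !sqr_l2norm_row mulr_sumr.
apply: ler_sum => i _; rewrite -exprMn -[leLHS]real_normK ?num_real//.
rewrite -[leRHS]real_normK ?num_real// ler_sqr ?nnegrE//.
rewrite mxE [X in _ + X]mxE ![multiplier _ _ _ _ _]mxE.
apply: le_trans (clip_lipschitz _ _ _) _.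
rewrite mulmxBl distrC /constr !mxE.
set p := \sum_j _; set q := \sum_j _.
by rewrite [X in `|X|](_ : _ = s * (q - p)) //; ring.
Qed.

Lemma lipschitz_grad_aug_lag L lam s : 0 < s ->
  (forall x, differentiable f x) -> lipschitz_grad L f ->
  lipschitz_grad (L + s * l2norm A ^+ 2) (aug_lag f A b lam s).
Proof.
move=> s0 df Lf x y; rewrite !grad_aug_lag// mulrDl.
set u := multiplier lam s x; set v := multiplier lam s y.
have -> : grad f x - u *m A - (grad f y - v *m A) =
    grad f x - grad f y + - ((u - v) *m A).
  by rewrite mulmxBl; move: (u *m A) (v *m A) => p q; rewrite !opprD !opprK
    addrACA.
apply: le_trans (l2normD _ _) _; apply: lerD; first exact: Lf.
rewrite l2normN; apply: le_trans (l2norm_mulmx _ _) _.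
apply: (le_trans (ler_wpM2l (l2norm_ge0 A) (multiplier_lipschitz _ _ _ (ltW s0)))).
by rewrite [leLHS](_ : _ = s * l2norm A ^+ 2 * l2norm (x - y)) //; ring.
Qed.

Lemma aug_lag_ge lam s x : 0 < s ->
  f x - (2 * s)^-1 * l2norm lam ^+ 2 <= aug_lag f A b lam s x.
Proof.
move=> s0; rewrite aug_lagE// lerD2l -mulrN ler_wpM2l//.
  by rewrite invr_ge0 mulr_ge0// ltW.
by rewrite lerDr sqr_ge0.
Qed.

(** At a feasible point the update fixes the equality multipliers and moves the others toward 0
    without crossing it, so the completed square is nonpositive. *)
Lemma aug_lag_feasible_le lam s x : 0 < s -> feasible A b x ->
  (forall i, 0 <= rsubmx lam 0 i) -> aug_lag f A b lam s x <= f x.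
Proof.
move=> s0 [cE cI] l0; rewrite aug_lagE// gerDl pmulr_rle0; last first.
  by rewrite invr_gt0 mulr_gt0.
rewrite subr_le0 !sqr_l2norm_row !big_split_ord/=.
apply: lerD; apply: ler_sum => i _.
  have := multiplierE lam s x i; rewrite mxE => ->.
  by rewrite cE mulr0 subr0 mxE.
have := multiplierI lam s x i; rewrite mxE => ->.
have -> : lam 0 (rshift me i) = rsubmx lam 0 i by rewrite mxE.
have := mulr_ge0 (ltW s0) (cI i) => sc.
have [_|h] := leP (rsubmx lam 0 i - s * consI A b x 0 i) 0.
  by rewrite expr0n/= sqr_ge0.
by rewrite ler_sqr ?nnegrE ?l0// ?gerBl// ltW.
Qed.

End AugmentedLagrangian.

(** * Elementary bounds on exponentials and powers *)

Section Bounds.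
Context {R : realType}.

Lemma geometric_powR_bounded (g a : R) : 0 < g < 1 -> 0 < a ->
  exists2 B, 0 <= B & forall T : nat, (0 < T)%N -> g ^+ T * T%:R `^ a <= B.
Proof.
move=> g01 a0; have [g0 _] := andP g01.
have u0 : 0 < - ln g / a by rewrite divr_gt0// oppr_gt0 ln_lt0.
(* With [u = - ln g / a], the inequality [ln (u * T) < u * T] times [a] bounds the exponent
   [T * ln g + a * ln T] by [- (a * ln u)]. *)
exists (expR (- (a * ln (- ln g / a)))) => [|T T0]; first exact: expR_ge0.
have T0' : 0 < T%:R :> R by rewrite ltr0n.
rewrite /powR gt_eqF// -[g in g ^+ T]lnK ?posrE// -expRM_natr -expRD ler_expR.
have := ln_sublinear (mulr_gt0 u0 T0'); rewrite lnM ?posrE// => h.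
have := ltW h; rewrite -(ler_pM2l a0) mulrDr.
have -> : a * (- ln g / a * T%:R) = - (ln g * T%:R) by field; rewrite gt_eqF.
lra.
Qed.

Lemma le_one_sqr (t : R) : t <= 1 + t ^+ 2.
Proof. by nra. Qed.

(** Selects the window length for (b): the second conjunct makes [theta] small, the third expresses
    the resulting cost as a power of [e]. *)
Lemma penalty_horizon (c a e : R) : 0 <= c -> 1 < a -> 0 < e < 1 ->
  exists T : nat, [/\ (0 < T)%N, c * T%:R `^ (1 - a) <= (e / 2) ^+ 2 &
    (3 * T%:R) `^ (a + 2) * e ^- 2 <=
    (3 * ((4 * c) `^ (a - 1)^-1 + 1)) `^ (a + 2) *
      e `^ (- (2 * (2 + a) / (a - 1) + 2))].
Proof.
move=> c0 a1 /andP[e0 e1]; set d := (4 * c) `^ _.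
have a0 : 0 < a - 1 by rewrite subr_gt0.
have d0 : 0 <= d by exact: powR_ge0.
set q := e `^ (- (2 / (a - 1))).
have q1 : 1 <= q.
  by rewrite -(powRr0 e) ger_powR ?e0 ?(ltW e1)// oppr_le0 divr_ge0 ?(ltW a0).
have q0 : 0 <= q by rewrite (le_trans ler01).
have qe : q `^ (a - 1) = e ^- 2.
  rewrite -powRrM mulNr divfK ?gt_eqF//; exact: (powR_invn 2 (ltW e0)).
(* The real solution of the second conjunct with equality is [d * q], as its power [a - 1] is
   [4 * c * e ^- 2]; rounding up costs at most 1, absorbed by [q >= 1]. *)
exists (Num.truncn (d * q)).+1.
have : d * q < (Num.truncn (d * q)).+1%:R by exact: truncnS_gt.
have : (Num.truncn (d * q)).+1%:R <= d * q + 1.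
  by rewrite -addn1 natrD lerD2r truncn_le// mulr_ge0.
have : (0 < (Num.truncn (d * q)).+1)%N by [].
move: (Num.truncn _).+1 => T T0 Tle Tgt; split => //.
  have T0' : 0 < T%:R :> R by rewrite ltr0n.
  rewrite -opprB powRN ler_pdivrMr ?powR_gt0//.
  apply: (@le_trans _ _ ((e / 2) ^+ 2 * (d * q) `^ (a - 1))).
    rewrite powRM// qe -powRrM mulVf ?gt_eqF// powRr1 ?mulr_ge0//.
    by rewrite [leRHS](_ : _ = c) //; field; rewrite gt_eqF.
  rewrite ler_wpM2l ?sqr_ge0// ge0_ler_powR ?nnegrE ?(ltW a0) ?mulr_ge0//.
  exact: ltW.
apply: (@le_trans _ _ ((3 * (d + 1) * q) `^ (a + 2) * e ^- 2)).
  rewrite ler_wpM2r ?invr_ge0 ?exprn_ge0 ?(ltW e0)//.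
  rewrite ge0_ler_powR ?nnegrE ?mulr_ge0 ?addr_ge0//; first lra.
  by nra.
rewrite powRM ?mulr_ge0 ?addr_ge0// -mulrA ler_wpM2l ?powR_ge0//.
rewrite -powRrM -(powR_invn 2 (ltW e0)) -powRD ?(gt_eqF e0) ?implybT//.
by rewrite [X in e `^ X](_ : _ = - (2 * (2 + a) / (a - 1) + 2)) //; field;
  rewrite gt_eqF.
Qed.

End Bounds.

(** * Growth of penalties and multipliers along a run *)

Section Run.
Context {R : realType} {n me mi : nat}.
Variables (f : 'rV[R]_n -> R) (A : 'M[R]_(me + mi, n)) (b : 'rV[R]_(me + mi)).
Variables (x0 : 'rV[R]_n) (lam0 : 'rV[R]_(me + mi)) (alpha sigma0 gamma eps : R).
Variables (x : nat -> 'rV[R]_n) (lam : nat -> 'rV[R]_(me + mi)) (sigma : nat -> R).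
Variables (f_low D W : R).
Hypothesis run : AL_run f A b x0 lam0 alpha sigma0 gamma eps x lam sigma.
Hypothesis sigma0_gt0 : 0 < sigma0.
Hypothesis f_diff : forall z, differentiable f z.
Hypothesis f_low_le : forall z, f_low <= f z.
Hypothesis x0_feasible : feasible A b x0.
Hypothesis lam0I_ge0 : forall i : 'I_mi, 0 <= rsubmx lam0 0 i.
Hypothesis gap_le : f x0 - f_low <= D.
Hypothesis lam0_le : l2norm lam0 ^+ 2 <= W.

Let theta := theta A b x lam sigma.
(* [G * k.+1] bounds |lam^(k)|^2 / sigma^(k) and the gap of subproblem [k]. *)
Let G := 2 * D + W / sigma0.

Lemma sigma_ndecr k : sigma k <= sigma k.+1.
Proof. by rewrite (AL_sigma run); case: ifP => // _; rewrite le_max lexx orbT. Qed.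

Lemma sigma_ge_sigma0 k : sigma0 <= sigma k.
Proof.
elim: k => [|k IH]; first by rewrite (AL_sigma0 run).
exact: le_trans IH (sigma_ndecr k).
Qed.

Lemma sigma_gt0 k : 0 < sigma k.
Proof. exact: lt_le_trans sigma0_gt0 (sigma_ge_sigma0 k). Qed.

(** Updates up to [m] never exceed [m ^ alpha >= 1]; the factor [sigma0 + 1] also covers the initial
    penalty. *)
Lemma sigma_le_powR k m : (k <= m)%N -> (0 < m)%N -> 1 < alpha ->
  sigma k <= (sigma0 + 1) * m%:R `^ alpha.
Proof.
move=> km m0 alpha1; have m1 : 1 <= m%:R `^ alpha.
  apply: (@le_trans _ _ (1 `^ alpha)); first by rewrite powR1.
  by rewrite ge0_ler_powR ?nnegrE ?ler1n//; lra.
have s0 := sigma0_gt0; elim: k km => [_|k IH km].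
  by rewrite (AL_sigma0 run); nra.
rewrite (AL_sigma run); case: ifP => [_|_]; first exact: IH (ltnW km).
rewrite ge_max IH ?andbT; last exact: ltnW.
apply: (@le_trans _ _ (m%:R `^ alpha)); last by nra.
by rewrite ge0_ler_powR ?nnegrE ?ler0n ?ler_nat//; lra.
Qed.

(** A failed test would have raised the penalty to at least [k.+1 ^ alpha]. *)
Lemma theta_decrease k : (0 < k)%N -> sigma k.+1 < k.+1%:R `^ alpha ->
  theta k.+1 <= gamma * theta k.
Proof.
move=> k0; rewrite (AL_sigma run) gtn_eqF//= -/theta.
by case: ifP => //= _; rewrite gt_max ltxx.
Qed.

Lemma theta_geometric a w : 0 <= gamma ->
  (forall k, (a <= k < a + w)%N -> theta k.+1 <= gamma * theta k) ->
  theta (a + w)%N <= gamma ^+ w * theta a.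
Proof.
move=> g0; elim: w => [_|w IH h]; first by rewrite addn0 expr0 mul1r.
rewrite addnS exprS -mulrA; apply: (le_trans (h _ _)).
  by rewrite leq_addr addnS ltnS leqnn.
rewrite ler_wpM2l// IH// => k /andP[ak kw]; apply: h.
by rewrite ak addnS ltnS ltnW.
Qed.

Lemma lam_multiplier k : lam k.+1 = multiplier A b (lam k) (sigma k) (x k.+1).
Proof.
apply/rowP => i; rewrite -(splitK i); case: (fintype.split i) => j /=.
  have := AL_lamE run k j; rewrite -multiplierE.
  by rewrite mxE => ->; rewrite mxE.
have := AL_lamI run k j; rewrite -multiplierI.
by rewrite mxE => ->; rewrite mxE.
Qed.

Lemma lamI_ge0 k (i : 'I_mi) : 0 <= rsubmx (lam k) 0 i.
Proof.
case: k => [|k]; first by rewrite (AL_lam0 run).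
by rewrite (AL_lamI run) le_max lexx orbT.
Qed.

Lemma sqr_lamS_le k :
  l2norm (lam k.+1) ^+ 2 <= l2norm (lam k) ^+ 2 + 2 * D * sigma k.
Proof.
have s0 := sigma_gt0 k; have := AL_decrease run k; rewrite le_min => /andP[_].
move=> /le_trans /(_ (aug_lag_feasible_le f s0 x0_feasible (lamI_ge0 k))).
rewrite aug_lagE// -lam_multiplier => h.
have {}h : (2 * sigma k)^-1 * (l2norm (lam k.+1) ^+ 2 - l2norm (lam k) ^+ 2)
    <= D by have := f_low_le (x k.+1); have := gap_le; lra.
move: h; rewrite mulrC ler_pdivrMr ?mulr_gt0//; lra.
Qed.

Lemma D_ge0 : 0 <= D.
Proof. by have := f_low_le x0; have := gap_le; lra. Qed.

Lemma W_ge0 : 0 <= W.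
Proof. exact: le_trans (sqr_ge0 _) lam0_le. Qed.

Lemma G_ge0 : 0 <= G.
Proof.
by rewrite addr_ge0 ?mulr_ge0 ?D_ge0 ?W_ge0// invr_ge0 ltW.
Qed.

(** Sums the one-step increments; as penalties never decrease, the last one stands for all earlier
    ones. *)
Lemma sqr_lam_le_sum k : l2norm (lam k.+1) ^+ 2 <= W + 2 * D * k.+1%:R * sigma k.
Proof.
have D0 := D_ge0; elim: k => [|k IH].
  by have := sqr_lamS_le 0; rewrite (AL_lam0 run) mulr1; have := lam0_le; lra.
apply: le_trans (sqr_lamS_le _) _.
have := ler_wpM2l (mulr_ge0 (ler0n R 2) (mulr_ge0 D0 (ler0n R k.+1))) (sigma_ndecr k).
rewrite (mulrSr 1 k.+1); lra.
Qed.

Lemma G_le k : (0 < k)%N -> W / sigma0 + 2 * D * k%:R <= G * k%:R.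
Proof.
move=> k0; have k1 : 1 <= k%:R :> R by rewrite ler1n.
have w0 : 0 <= W / sigma0 by rewrite divr_ge0 ?W_ge0// ltW.
by rewrite /G; nra.
Qed.

Lemma W_le k : W <= W / sigma0 * sigma k.
Proof.
rewrite mulrAC -mulrA ler_peMr ?W_ge0// ler_pdivlMr// mul1r.
exact: sigma_ge_sigma0.
Qed.

Lemma sqr_lamS_bound k : l2norm (lam k.+1) ^+ 2 <= G * k.+1%:R * sigma k.
Proof.
apply: le_trans (sqr_lam_le_sum k) _.
have := W_le k; have := ler_wpM2r (ltW (sigma_gt0 k)) (G_le (ltn0Sn k)).
by rewrite mulrDl; lra.
Qed.

Lemma sqr_lam_le k :
  l2norm (lam k) ^+ 2 <= (W / sigma0 + 2 * D * k%:R) * sigma k.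
Proof.
rewrite mulrDl; case: k => [|k].
  by rewrite mulr0 mul0r addr0 (AL_lam0 run) (le_trans lam0_le (W_le 0)).
apply: le_trans (sqr_lam_le_sum k) _.
apply: lerD (W_le _) _; rewrite ler_wpM2l ?sigma_ndecr//.
by rewrite !mulr_ge0// D_ge0.
Qed.

Lemma sqr_lam_bound k : l2norm (lam k) ^+ 2 <= G * k.+1%:R * sigma k.
Proof.
apply: le_trans (sqr_lam_le k) _; rewrite ler_wpM2r ?(ltW (sigma_gt0 k))//.
apply: le_trans (G_le (ltn0Sn k)); rewrite lerD2l ler_wpM2l ?ler_nat//.
by rewrite mulr_ge0 ?D_ge0.
Qed.

(** * The residual [theta] and approximate KKT points *)

Lemma theta_ge0 k : 0 <= theta k.
Proof. by rewrite le_max normr_ge0. Qed.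

Lemma lam_eqE k : consE A b (x k.+1) - (sigma k)^-1 *: lsubmx (lam k) =
  - ((sigma k)^-1 *: lsubmx (lam k.+1)).
Proof.
apply/rowP => i; have := AL_lamE run k i; have := sigma_gt0 k.
move: (consE A b (x k.+1)) => c s0; rewrite !mxE => ->.
by field; rewrite gt_eqF.
Qed.

(* The infeasibility and complementarity residuals at [x k.+1] are, up to the
   factor [sigma k], dominated by the multipliers before and after the step. *)
Lemma theta_le k t : l2norm (lam k) <= sigma k * t ->
  l2norm (lam k.+1) <= sigma k * t -> theta k.+1 <= t.
Proof.
move=> h1 h2; have s0 := sigma_gt0 k.
have t0 : 0 <= t by rewrite -(pmulr_rge0 _ s0) (le_trans (l2norm_ge0 _) h1).
have c2 j : `|lam k.+1 0 j| <= sigma k * t.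
  apply: le_trans (row_norm_coord _ _) _.
  exact: le_trans (row_norm_le_l2norm _) h2.
rewrite /theta /Defs.theta /= !ge_max; apply/and3P; split.
- rewrite normrZ gtr0_norm ?invr_gt0// mulrC ler_pdivrMr// mulrC.
  exact: le_trans (row_norm_le_l2norm _) h1.
- rewrite lam_eqE normrN normrZ gtr0_norm ?invr_gt0// mulrC ler_pdivrMr// mulrC.
  apply/row_normP => [|i]; first by rewrite mulr_ge0// ltW.
  by rewrite mxE.
(* At a violated inequality the old multiplier is nonnegative, so the new one is at least [sigma k]
   times the violation. *)
- apply/row_normP => // i; rewrite mxE.
  have := c2 (rshift me i); have := AL_lamI run k i; rewrite mxE => ->.
  set c := consI _ _ _ _ _; have l0 := lamI_ge0 k i.
  rewrite ger0_norm ?le_max ?lexx ?orbT// ge_max => /andP[h _].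
  have [_|cn] := leP 0 c; first by rewrite normr0.
  rewrite ltr0_norm// -(ler_pM2l s0); lra.
Qed.

(** Both multiplier bounds have the form [(sigma k * t) ^+ 2] with [t] the square root of the
    right-hand side. *)
Lemma sqr_theta_le k : theta k.+1 ^+ 2 <= G * k.+1%:R / sigma k.
Proof.
have s0 := sigma_gt0 k; have G0 := G_ge0; set q := _ / _.
have q0 : 0 <= q by rewrite divr_ge0 ?mulr_ge0// ltW.
rewrite -(sqr_sqrtr q0) ler_sqr ?nnegrE ?theta_ge0//.
have sq2 : (sigma k * Num.sqrt q) ^+ 2 = G * k.+1%:R * sigma k.
  by rewrite exprMn sqr_sqrtr// /q; field; rewrite gt_eqF.
apply: theta_le; rewrite -ler_sqr ?nnegrE ?l2norm_ge0 ?mulr_ge0 ?(ltW s0)//;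
  rewrite sq2; [exact: sqr_lam_bound | exact: sqr_lamS_bound].
Qed.

(** The half serves twice: the equality residual is split into two terms of [theta], and a
    constraint value above [eps] outweighs an old multiplier of at most [sigma k * eps / 2], so that
    the projection gives 0. *)
Lemma theta_small_KKT k : 0 < eps -> theta k.+1 <= eps / 2 ->
  approx_KKT f A b eps (x k.+1) (lam k.+1).
Proof.
move=> eps0; have s0 := sigma_gt0 k.
rewrite /theta /Defs.theta /= !ge_max => /and3P[h1 h2 h3]; split.
- rewrite grad_lagrangian// lam_multiplier -(grad_aug_lag A b _ s0)//.
  exact: AL_stationary run k.
- have -> : consE A b (x k.+1) = consE A b (x k.+1)
      - (sigma k)^-1 *: lsubmx (lam k) + lsubmx ((sigma k)^-1 *: lam k).
    by apply/rowP => i; rewrite !mxE subrK.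
  apply: le_trans (ler_normD _ _) _.
  have : `|lsubmx ((sigma k)^-1 *: lam k)| <= eps / 2; last by lra.
  apply/row_normP => [|i]; first lra.
  by rewrite mxE; apply: le_trans h1; exact: row_norm_coord.
- by apply: le_trans h3 _; lra.
- move=> i; split; first exact: lamI_ge0.
  rewrite (AL_lamI run) => hc; apply/max_idPr.
  have := le_trans (row_norm_coord _ (rshift me i)) h1.
  rewrite mxE => /(le_trans (ler_norm _)); rewrite mulrC ler_pdivrMr// => h.
  have : sigma k * eps <= sigma k * consI A b (x k.+1) 0 i.
    by rewrite ler_wpM2l// ltW.
  have -> : rsubmx (lam k) 0 i = lam k 0 (rshift me i) by rewrite mxE.
  have := mulr_gt0 s0 eps0; lra.
Qed.

(** * Cost of the inner iterations *)

Variables (M : method R n) (CM L Lambda : R).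
Variables (y : nat -> 'rV[R]_n) (N : nat -> nat).
Hypothesis CM_gt0 : 0 < CM.
Hypothesis M_complexity : assumption_A4 CM M.
Hypothesis L_ge0 : 0 <= L.
Hypothesis f_lip : lipschitz_grad L f.
Hypothesis A_le : l2norm A ^+ 2 <= Lambda.
Hypothesis eps01 : 0 < eps < 1.
Hypothesis inner : inner_run f A b M eps x lam sigma y N.

Lemma inner_iterations_le k m S : (k < m)%N -> sigma k <= S ->
  (N k)%:R <= CM * (L + S * Lambda) * (G * m%:R) * eps ^- 2.
Proof.
move=> km kS; have s0 := sigma_gt0 k.
have m0 : (0 < m)%N := leq_ltn_trans (leq0n k) km.
set P := aug_lag f A b (lam k) (sigma k).
set g_low := f_low - (2 * sigma k)^-1 * l2norm (lam k) ^+ 2.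
have P_low z : g_low <= P z.
  apply: le_trans (aug_lag_ge f A b (lam k) z s0).
  by rewrite lerD2r.
have := M_complexity (y k) eps01
  (fun z => differentiable_aug_lag A b (lam k) s0 (f_diff z)) P_low
  (lipschitz_grad_aug_lag A b (lam k) s0 f_diff f_lip).
move=> [j jle jstat].
(* The method does not run past a Euclidean [eps]-stationary iterate, so the index supplied by A4
   bounds [N k]. *)
have Nj : (N k <= j)%N.
  rewrite leqNgt; apply/negP => /(inner_stop inner).
  by rewrite ltNge jstat.
apply: (@le_trans _ _ j%:R); first by rewrite ler_nat.
apply: le_trans jle _; rewrite ler_wpM2r ?invr_ge0 ?exprn_ge0//.
  by case/andP: eps01 => /ltW.
have A20 := sqr_ge0 (l2norm A).
apply: ler_pM.
- apply: mulr_ge0; first exact: ltW.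
  by apply: addr_ge0 => //; apply: mulr_ge0 => //; exact: ltW.
- by rewrite subr_ge0.
- by apply: ler_wpM2l; [exact: ltW | rewrite lerD2l ler_pM// ltW].
have Py : P (y k) <= f x0.
  apply: (@le_trans _ _ (P x0)); last exact: aug_lag_feasible_le (lamI_ge0 k).
  have := inner_argmin inner k; rewrite le_min (AL_x0 run).
  by case/andP.
have lk : (2 * sigma k)^-1 * l2norm (lam k) ^+ 2 <=
    2^-1 * (W / sigma0 + 2 * D * k%:R).
  rewrite mulrC ler_pdivrMr ?mulr_gt0//.
  apply: le_trans (sqr_lam_le k) _.
  rewrite [leRHS](_ : _ = (W / sigma0 + 2 * D * k%:R) * sigma k) //.
  by field; rewrite gt_eqF.
have D0 := D_ge0; have w0 : 0 <= W / sigma0 by rewrite divr_ge0 ?W_ge0// ltW.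
have km' : k.+1%:R <= m%:R :> R by rewrite ler_nat.
have m1 : 1 <= m%:R :> R by rewrite ler1n.
have := ler_wpM2l D0 km'; have := ler_wpM2l w0 m1; have := gap_le.
rewrite -/P (mulrSr 1 k) /g_low /G.
move: (P (y k)) (_^-1 * _ ^+ 2) (W / sigma0) Py lk w0 => p l w; nra.
Qed.

(** One factor [K] counts the subproblems, the other bounds their gaps; [sigma0 <= S] turns [L] into
    a multiple of [S]. *)
Lemma inner_total_le K S : (0 < K)%N -> (forall k, (k < K)%N -> sigma k <= S) ->
  (\sum_(k < K) N k)%N%:R <=
  CM * G * (L / sigma0 + Lambda) * (S * K%:R ^+ 2 * eps ^- 2).
Proof.
move=> K0 hS; have S0 : sigma0 <= S by rewrite -(AL_sigma0 run) hS.
rewrite natr_sum.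
apply: (@le_trans _ _ (\sum_(k < K) (CM * (L + S * Lambda) * (G * K%:R) * eps ^- 2))).
  by apply: ler_sum => k _; apply: inner_iterations_le => //; exact: hS.
rewrite sumr_const card_ord -[leLHS]mulr_natr.
have -> : CM * (L + S * Lambda) * (G * K%:R) * eps ^- 2 * K%:R =
  CM * G * (L + S * Lambda) * (K%:R ^+ 2 * eps ^- 2) by ring.
have -> : CM * G * (L / sigma0 + Lambda) * (S * K%:R ^+ 2 * eps ^- 2) =
  CM * G * (L * (S / sigma0) + S * Lambda) * (K%:R ^+ 2 * eps ^- 2) by ring.
have e0 : 0 <= eps by case/andP: eps01 => /ltW.
rewrite ler_wpM2r ?mulr_ge0 ?exprn_ge0 ?invr_ge0 ?exprn_ge0//.
rewrite ler_wpM2l ?mulr_ge0 ?G_ge0 ?(ltW CM_gt0)//.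
by rewrite lerD2r ler_peMr// ler_pdivlMr// mul1r.
Qed.

Lemma KKT_within_of_theta K S : (0 < K)%N -> theta K <= eps / 2 ->
  (forall k, (k < K)%N -> sigma k <= S) ->
  KKT_within f A b eps x lam N
    (CM * G * (L / sigma0 + Lambda) * (S * K%:R ^+ 2 * eps ^- 2)).
Proof.
move=> K0 hth hS; exists K; split => //; last exact: inner_total_le.
case: K K0 hth {hS} => // k _; apply: theta_small_KKT.
by case/andP: eps01.
Qed.

(** * Number of outer iterations in the two penalty regimes *)

Hypothesis alpha_gt1 : 1 < alpha.
Hypothesis gamma01 : 0 < gamma < 1.

Let H := CM * G * (L / sigma0 + Lambda).

Lemma Lambda_ge0 : 0 <= Lambda.
Proof. exact: le_trans (sqr_ge0 _) A_le. Qed.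

Lemma H_ge0 : 0 <= H.
Proof.
rewrite /H !mulr_ge0 ?G_ge0 ?(ltW CM_gt0)// addr_ge0 ?Lambda_ge0//.
by rewrite divr_ge0// ltW.
Qed.

Lemma KKT_within_le B B' : B <= B' -> KKT_within f A b eps x lam N B ->
  KKT_within f A b eps x lam N B'.
Proof. by move=> BB' [K [K0 hK hB]]; exists K; split => //; exact: le_trans BB'. Qed.

Lemma KKT_within_bounded sigma_max : (forall k, sigma k <= sigma_max) ->
  eps < expR (- (Num.truncn sigma_max).+1%:R) ->
  eps < (2 * (1 + G / sigma0 * (Num.truncn sigma_max).+1%:R))^-1 ->
  KKT_within f A b eps x lam N
    (H * (sigma_max * ((2 + 2 / - ln gamma) * `|ln eps|) ^+ 2 * eps ^- 2)).
Proof.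
move=> sM; set k0 := (Num.truncn sigma_max).+1 => e1 e2.
have [eps0 eps1] := andP eps01; have [gam0 _] := andP gamma01.
have sk0 : sigma_max < k0%:R by exact: truncnS_gt.
have k0_gt0 : (0 < k0)%N by [].
have k01 : 1 <= k0%:R :> R by rewrite ler1n.
clearbody k0.
have lg : 0 < - ln gamma by rewrite oppr_gt0 ln_lt0.
have le0 : ln eps < 0 by rewrite ln_lt0.
rewrite ltr0_norm//; set l := - ln eps.
(* The first smallness condition on [eps]: both [k0] and the rounding 1 in [w] are then at most [l],
   whence the 2 in the final constant. *)
have k0l : k0%:R < l by move: e1; rewrite -ltr_ln ?posrE ?expR_gt0// expRK /l; lra.
(* Enough contractions for [gamma ^+ w <= eps ^+ 2]: one factor [eps] is kept, the other absorbs the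
   bound [Th] on [theta k0] by the second smallness condition. *)
set w := (Num.truncn (2 * l / - ln gamma)).+1.
have wgt : 2 * l / - ln gamma < w%:R by exact: truncnS_gt.
have wle : w%:R <= 2 * l / - ln gamma + 1.
  rewrite /w -addn1 natrD lerD2r truncn_le// divr_ge0 ?(ltW lg)// /l; lra.
(* From [k0] on, [k.+1 ^ alpha >= k.+1 > sigma_max], so the test cannot fail. *)
clearbody w; have dec k : (k0 <= k < k0 + w)%N -> theta k.+1 <= gamma * theta k.
  move=> /andP[k0k _]; apply: theta_decrease; first exact: leq_trans k0k.
  apply: le_lt_trans (sM _) _; apply: (lt_le_trans sk0).
  apply: (@le_trans _ _ k.+1%:R); first by rewrite ler_nat (leqW k0k).
  by rewrite le1r_powR ?ler1n ?(ltW alpha_gt1).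
have gw : gamma ^+ w <= eps ^+ 2.
  rewrite -ler_ln ?posrE ?exprn_gt0// !lnXn// -[ln gamma *+ w]mulr_natr.
  move: wgt; rewrite ltr_pdivrMr// /l mulr2n; lra.
set Th := 1 + G / sigma0 * k0%:R.
have Th1 : 1 <= Th.
  by rewrite lerDl mulr_ge0// divr_ge0 ?G_ge0// ltW.
have thk0 : theta k0 <= Th.
  apply: le_trans (le_one_sqr _) _; rewrite lerD2l.
  rewrite -(prednK k0_gt0); apply: le_trans (sqr_theta_le _) _.
  rewrite [leRHS]mulrAC ler_wpM2l ?mulr_ge0 ?G_ge0//.
  by rewrite lef_pV2 ?posrE ?sigma_gt0 ?sigma_ge_sigma0.
have small : theta (k0 + w)%N <= eps / 2.
  apply: le_trans (theta_geometric (ltW gam0) dec) _.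
  apply: (@le_trans _ _ (eps ^+ 2 * Th)).
    by apply: ler_pM => //; rewrite ?theta_ge0 ?exprn_ge0 ?(ltW gam0).
  rewrite expr2 -mulrA ler_wpM2l ?(ltW eps0)//.
  have Th0 : 0 < 2 * Th by rewrite mulr_gt0// (lt_le_trans ltr01 Th1).
  have : eps * (2 * Th) < 1 by rewrite -ltr_pdivlMr// mul1r.
  by rewrite mulrCA => /ltW h; rewrite -[leRHS]mulr1 ler_pdivlMl ?ltr0n.
have K0 : (0 < k0 + w)%N by rewrite addn_gt0 k0_gt0.
apply: KKT_within_le (KKT_within_of_theta K0 small (fun k _ => sM k)).
rewrite -/H ler_wpM2l ?H_ge0// ler_wpM2r ?invr_ge0 ?exprn_ge0 ?(ltW eps0)//.
rewrite ler_wpM2l ?(le_trans _ (sM 0))//; first by rewrite (AL_sigma0 run) ltW.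
have l0 : 0 <= l by rewrite /l; lra.
rewrite ler_sqr ?nnegrE//; last first.
  by rewrite mulr_ge0// addr_ge0// divr_ge0// ltW.
rewrite natrD mulrDl.
have -> : 2 / - ln gamma * l = 2 * l / - ln gamma by rewrite mulrAC.
lra.
Qed.

(** The two summands [2 * G] and [G / sigma0 * B] serve the cases of a failed test in the window and
    of none. *)
Lemma KKT_within_penalty B T : 0 <= B -> (0 < T)%N ->
  gamma ^+ T * T%:R `^ alpha <= B ->
  (2 * G + G / sigma0 * B) * T%:R `^ (1 - alpha) <= (eps / 2) ^+ 2 ->
  KKT_within f A b eps x lam N
    (H * ((sigma0 + 1) * (3 * T%:R) `^ (alpha + 2) * eps ^- 2)).
Proof.
move=> B0 T0 hB hT; have [eps0 eps1] := andP eps01; have [gam0 gam1] := andP gamma01.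
have T0' : 0 < T%:R :> R by rewrite ltr0n.
have T1' : 1 <= T%:R :> R by rewrite ler1n.
have G0 := G_ge0; have pT0 := powR_ge0 (T%:R : R) (1 - alpha).
have GB0 : 0 <= G / sigma0 * B by rewrite !mulr_ge0 ?invr_ge0// ltW.
suff [K [K0 KT thK]] : exists K, [/\ (0 < K)%N, (K <= 3 * T)%N & theta K <= eps / 2].
  have TT0 : (0 < 3 * T)%N by rewrite muln_gt0.
  have hS k : (k < K)%N -> sigma k <= (sigma0 + 1) * (3 * T)%N%:R `^ alpha.
    by move=> kK; apply: sigma_le_powR => //; exact: leq_trans (ltnW kK) KT.
  apply: KKT_within_le (KKT_within_of_theta K0 thK hS).
  rewrite -/H ler_wpM2l ?H_ge0// ler_wpM2r ?invr_ge0 ?exprn_ge0 ?(ltW eps0)//.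
  rewrite -natrM powRD; last by rewrite pnatr_eq0 -lt0n TT0 implybT.
  rewrite powR_mulrn ?ler0n// mulrA ler_wpM2l//.
    by rewrite mulr_ge0 ?powR_ge0// addr_ge0// ltW.
  by rewrite ler_sqr ?nnegrE ?ler0n// ler_nat.
have root t : 0 <= t -> t ^+ 2 <= (2 * G + G / sigma0 * B) * T%:R `^ (1 - alpha) ->
    t <= eps / 2.
  move=> t0 /le_trans /(_ hT); rewrite ler_sqr ?nnegrE//.
  by rewrite divr_ge0// ltW.
have [[k [Tk kT upd]]|noupd] := pselect (exists k, [/\ (T <= k)%N, (k < T + T)%N &
    gamma * theta k < theta k.+1]).
  (* The penalty raised by the failed test is [sigma k.+1], which first bounds [theta k.+2]. *)
  exists k.+2; split => //; first by move: T0 kT; clear; lia.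
  apply: root; first exact: theta_ge0.
  have k0 : (0 < k)%N := leq_trans T0 Tk.
  have sk : k.+1%:R `^ alpha <= sigma k.+1.
    rewrite leNgt; apply/negP => /(theta_decrease k0).
    by rewrite leNgt upd.
  apply: le_trans (sqr_theta_le _) _.
  have k1 : 1 <= k.+1%:R :> R by rewrite ler1n.
  have pk : 0 < k.+1%:R `^ alpha :> R by rewrite powR_gt0.
  (* The factor 2 comes from [k.+2 <= 2 * k.+1]. *)
  apply: (@le_trans _ _ (2 * G * k.+1%:R `^ (1 - alpha))).
    rewrite powRB ?pnatr_eq0 ?implybT// powRr1// mulrA.
    apply: ler_pM; rewrite ?mulr_ge0 ?invr_ge0 ?(ltW (sigma_gt0 _))//.
      by rewrite -mulrA mulrCA ler_wpM2l// (mulrSr 1 k.+1); lra.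
    by rewrite lef_pV2 ?posrE ?sigma_gt0.
  apply: ler_pM; rewrite ?powR_ge0 ?mulr_ge0// ?lerDl//.
  have am : 0 <= alpha - 1 by rewrite subr_ge0 ltW.
  rewrite -opprB !powRN lef_pV2 ?posrE ?powR_gt0//.
  by rewrite ge0_ler_powR ?nnegrE ?ler_nat// ltnW.
exists (T + T)%N; split; [by rewrite addn_gt0 T0 | by move: T0; clear; lia | ].
apply: root; first exact: theta_ge0.
have dec k : (T <= k < T + T)%N -> theta k.+1 <= gamma * theta k.
  move=> /andP[Tk kT]; rewrite leNgt; apply/negP => upd.
  by apply: noupd; exists k.
have tg := theta_geometric (ltW gam0) dec.
have gT0 : 0 <= gamma ^+ T by rewrite exprn_ge0 ?(ltW gam0).
have gT1 : gamma ^+ T <= 1 by rewrite exprn_ile1 ?(ltW gam0) ?(ltW gam1).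
have thT : theta T ^+ 2 <= G / sigma0 * T%:R.
  rewrite -(prednK T0); apply: le_trans (sqr_theta_le _) _.
  rewrite [leRHS]mulrAC ler_wpM2l ?mulr_ge0//.
  by rewrite lef_pV2 ?posrE ?sigma_gt0 ?sigma_ge_sigma0.
apply: (@le_trans _ _ ((gamma ^+ T * theta T) ^+ 2)).
  by rewrite ler_sqr ?nnegrE ?theta_ge0 ?mulr_ge0 ?theta_ge0.
(* One of the two factors [gamma ^+ T] is bounded by 1; the other, paired with [T ^ alpha], is
   controlled by [B]. *)
rewrite exprMn; apply: (@le_trans _ _ (gamma ^+ T * (G / sigma0 * T%:R))).
  apply: ler_pM; rewrite ?sqr_ge0//.
  by rewrite expr2 ler_piMr.
apply: (@le_trans _ _ (G / sigma0 * B * T%:R `^ (1 - alpha))).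
  rewrite powRB ?pnatr_eq0 ?implybT// ?powRr1// -?lt0n ?T0 ?implybT//.
  have pT : 0 < T%:R `^ alpha :> R by rewrite powR_gt0.
  rewrite mulrCA -!mulrA ler_wpM2l// ler_wpM2l ?invr_ge0 ?(ltW sigma0_gt0)//.
  rewrite [leRHS]mulrCA [leLHS]mulrC ler_wpM2l// ler_pdivlMr//.
by rewrite ler_wpM2r// lerDr mulr_ge0.
Qed.

End Run.

(* The constant [C] hidden in both O(.) depends only on the data listed before
   it ([Delta], [Lambda], [rho] bound [f x0 - f_low], the norm of the constraint
   matrix and that of the initial multipliers), not on [n], [eps] or
   [sigma_max].  As [|ln eps|] vanishes at [eps = 1], (a) is for [eps] small. *)
Theorem theorem3p4 (R : realType) (me mi : nat)
    (L1 Delta Lambda rho alpha sigma0 gamma CM : R)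
    (halpha : 1 < alpha) (hsigma0 : 0 < sigma0) (hgamma : 0 < gamma < 1)
    (hCM : 0 < CM) :
  exists (C : R) (eps0 : R -> R),
    0 < C /\ (forall s, 0 < eps0 s) /\
    forall (n : nat) (f : 'rV[R]_n -> R) (f_low : R)
      (A : 'M[R]_(me + mi, n)) (b : 'rV[R]_(me + mi))
      (x0 : 'rV[R]_n) (lam0 : 'rV[R]_(me + mi)) (M : method R n),
    (0 < n)%N ->
    assumption_A1 f_low f -> assumption_A3 L1 f ->
    (forall (i : 'I_mi) (j : 'I_n), 0 <= A (rshift me i) j) ->
    feasible A b x0 -> (forall i : 'I_mi, 0 <= rsubmx lam0 0 i) ->
    monotone_method M -> assumption_A4 CM M ->
    f x0 - f_low <= Delta -> l2norm A <= Lambda -> l2norm lam0 <= rho ->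
    forall (eps : R) (x : nat -> 'rV[R]_n) (lam : nat -> 'rV[R]_(me + mi))
      (sigma : nat -> R) (y : nat -> 'rV[R]_n) (N : nat -> nat),
    0 < eps < 1 ->
    AL_run f A b x0 lam0 alpha sigma0 gamma eps x lam sigma ->
    inner_run f A b M eps x lam sigma y N ->
    (* (a) *)
    (forall sigma_max : R,
       (forall k, sigma k <= sigma_max) -> eps < eps0 sigma_max ->
       KKT_within f A b eps x lam N
         (C * (sigma_max * Num.sqrt n%:R * `|ln eps| ^+ 2 * eps ^- 2)))
    /\
    (* (b) *)
    (sigma k @[k --> \oo] --> +oo -> 2 <= alpha -> alpha \is a Num.int ->
       KKT_within f A b eps x lam N
         (C * (Num.sqrt n%:R *
               eps `^ (- (2 * (2 + alpha) / (alpha - 1) + 2))))).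
Proof.
have [gam0 _] := andP hgamma; have alpha0 : 0 < alpha := lt_trans ltr01 halpha.
have [B B0 hB] := geometric_powR_bounded hgamma alpha0.
have lg : 0 < - ln gamma by rewrite oppr_gt0 ln_lt0.
(* These constants instantiate the run estimates with the uniform bounds; absolute values make those
   coming from [Delta] and [L1] nonnegative. *)
set G := 2 * `|Delta| + rho ^+ 2 / sigma0.
have G0 : 0 <= G.
  apply: addr_ge0; first by rewrite mulr_ge0.
  by apply: divr_ge0; [exact: sqr_ge0 | exact: ltW].
set H := CM * G * (`|L1| / sigma0 + Lambda ^+ 2).
have H0 : 0 <= H.
  rewrite /H !mulr_ge0 ?(ltW hCM)// addr_ge0 ?sqr_ge0//.
  by rewrite divr_ge0// ltW.
set kap := 2 + 2 / - ln gamma.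
set c := 2 * G + G / sigma0 * B.
have c0 : 0 <= c.
  by rewrite /c addr_ge0 ?mulr_ge0// invr_ge0 ltW.
set d := (sigma0 + 1) * (3 * ((4 * c) `^ (alpha - 1)^-1 + 1)) `^ (alpha + 2).
have d0 : 0 <= d by rewrite mulr_ge0 ?powR_ge0// addr_ge0// ltW.
pose k0 (s : R) : R := (Num.truncn s).+1%:R.
(* The constants of (a) and (b) are added, and 1 ensures positivity. *)
exists (H * kap ^+ 2 + H * d + 1).
exists (fun s => Num.min (expR (- k0 s)) (2 * (1 + G / sigma0 * k0 s))^-1).
have Hk0 : 0 <= H * kap ^+ 2 by apply: mulr_ge0 => //; exact: sqr_ge0.
have Hd0 : 0 <= H * d by exact: mulr_ge0.
split; first by apply: ltr_wpDl => //; exact: addr_ge0.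
split=> [s|].
  rewrite lt_min expR_gt0 invr_gt0; apply: mulr_gt0 => //.
  by apply: ltr_pwDl => //; rewrite mulr_ge0 ?ler0n// divr_ge0// ltW.
move=> n f f_low A b x0 lam0 M n0 [fdiff _ flow _] fL _ feas lam0I _ A4.
move=> hDelta hLambda hrho eps x lam sigma y N eps01 run inner.
have hD : f x0 - f_low <= `|Delta| := le_trans hDelta (ler_norm _).
have hW : l2norm lam0 ^+ 2 <= rho ^+ 2.
  by rewrite ler_sqr ?nnegrE ?l2norm_ge0// (le_trans (l2norm_ge0 _) hrho).
have hA : l2norm A ^+ 2 <= Lambda ^+ 2.
  by rewrite ler_sqr ?nnegrE ?l2norm_ge0// (le_trans (l2norm_ge0 _) hLambda).
have fL' : lipschitz_grad `|L1| f.
  move=> u v; apply: le_trans (fL u v) _.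
  by rewrite ler_wpM2r ?l2norm_ge0 ?ler_norm.
(* This inserts the dimension factor into both bounds. *)
have sqn : 1 <= Num.sqrt n%:R :> R by rewrite -[leLHS]sqrtr1 ler_wsqrtr// ler1n.
have [eps0 _] := andP eps01.
split=> [sigma_max hs|_ _ _].
  rewrite lt_min => /andP[e1 e2].
  have s0 : 0 <= sigma_max.
    by apply: le_trans (hs 0%N); rewrite (AL_sigma0 run) ltW.
  apply: KKT_within_le (KKT_within_bounded run hsigma0 fdiff flow feas lam0I
    hD hW hCM A4 (normr_ge0 L1) fL' hA eps01 inner halpha hgamma hs e1 e2).
  rewrite -/G -/H -/kap exprMn.
  set l2 := `|ln eps| ^+ 2; set e2' := eps ^- 2.
  have se : 0 <= sigma_max * l2 * e2'.
    by rewrite /l2 /e2' !mulr_ge0 ?invr_ge0 ?sqr_ge0.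
  rewrite [leLHS](_ : _ = H * kap ^+ 2 * (1 * (sigma_max * l2 * e2'))); last by ring.
  rewrite [X in _ <= _ * X](_ : _ = Num.sqrt n%:R * (sigma_max * l2 * e2')); last by ring.
  apply: ler_pM => //; first by rewrite mul1r.
    by rewrite -addrA lerDl addr_ge0.
  exact: ler_wpM2r.
have [T [T0 hT1 hT2]] := penalty_horizon c0 halpha eps01.
apply: KKT_within_le (KKT_within_penalty run hsigma0 fdiff flow feas lam0I
  hD hW hCM A4 (normr_ge0 L1) fL' hA eps01 inner halpha hgamma B0 T0 (hB T T0) hT1).
rewrite -/G -/H; set e' := eps `^ _.
apply: (@le_trans _ _ (H * d * (1 * e'))).
  clearbody H; rewrite mul1r /d -!mulrA ler_wpM2l// ler_wpM2l//.
  by rewrite addr_ge0// ltW.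
have e'0 : 0 <= e' by exact: powR_ge0.
apply: ler_pM => //; first by rewrite mul1r.
  by rewrite addrAC lerDr addr_ge0.
exact: ler_wpM2r.
Qed.
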